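(* Let $\pi_1,\pi_2$ be irreducible smooth representations of $G_{n+1}=\mathrm{GL}_{n+1}(F)$ and $G_n=\mathrm{GL}_n(F)$ respectively. Then $$\mathrm{Hom}_{G_n}(\pi_2,\pi_1|_{G_n})\neq 0$$ if and only if both $\pi_1$ and $\pi_2$ are one-dimensional and $\pi_2=\pi_1|_{G_n}$.
   Context: $F$ is a non-Archimedean local field and $G_n=\mathrm{GL}_n(F)$. All representations are smooth and over $\mathbb{C}$. $G_n$ is viewed as a subgroup of $G_{n+1}$ via $g\mapsto\mathrm{diag}(g,1)$. *)

(* Defs.v *)
From HB Require Import structures.
From mathcomp Require Import all_boot all_order all_algebra.
From mathcomp Require Import all_classical all_reals all_analysis.
From mathcomp Require Import complex.

Set Implicit Arguments.
Unset Strict Implicit.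
Unset Printing Implicit Defensive.

Import Order.TTheory GRing.Theory Num.Theory.

Local Open Scope classical_set_scope.
Local Open Scope ring_scope.

(* A non-Archimedean local field: a field that is locally compact for the
   topology of a nontrivial ultrametric absolute value.  Completeness,
   discreteness of the valuation and finiteness of the residue field follow. *)
HB.mixin Record isNonArchLocalField (R : realType) F
    of GRing.Field F & Topological F := {
  absv : F -> R;
  absv_ge0 : forall x, 0 <= absv x;
  absv_eq0 : forall x, (absv x == 0) = (x == 0);
  absvM : {morph absv : x y / x * y};
  absvD_max : forall x y, absv (x + y) <= Num.max (absv x) (absv y);
  absv_nontrivial : exists x, x != 0 /\ absv x != 1;
  nbhs_absvE : forall x : F,
    nbhs x = filter_from [set e : R | 0 < e]
                         (fun e => [set y | absv (y - x) < e]);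
  absv_locally_compact : locally_compact [set: F]
}.

#[short(type="nonArchLocalFieldType")]
HB.structure Definition NonArchLocalField (R : realType) :=
  {F of GRing.Field F & Topological F & isNonArchLocalField R F}.

(* As in the library, "pre" means that the group operations are not required
   to be continuous. *)
#[short(type="preTopologicalGroupType")]
HB.structure Definition PreTopologicalGroup := {G of Group G & Topological G}.

(* 'GL_n of the library is restricted to finite rings and positive n. *)
Definition GL (F : fieldType) (n : nat) := {A : 'M[F]_n | A \in unitmx}.

HB.instance Definition _ (F : fieldType) n := Choice.on (GL F n).
HB.instance Definition _ (F : fieldType) n := SubType.on (GL F n).

Section GLGroup.
Variables (F : fieldType) (n : nat).
Implicit Types g h : GL F n.

Definition GL_one : GL F n := exist _ 1%:M (unitmx1 F n).

Lemma GL_mul_subproof g h : val g *m val h \in unitmx.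
Proof. by rewrite unitmx_mul (valP g) (valP h). Qed.
Definition GL_mul g h : GL F n := exist _ (val g *m val h) (GL_mul_subproof g h).

Lemma GL_inv_subproof g : invmx (val g) \in unitmx.
Proof. by rewrite unitmx_inv (valP g). Qed.
Definition GL_inv g : GL F n := exist _ (invmx (val g)) (GL_inv_subproof g).

Lemma GL_mulA : associative GL_mul.
Proof. by move=> g h k; apply: val_inj; exact: mulmxA. Qed.
Lemma GL_mul1 : left_id GL_one GL_mul.
Proof. by move=> g; apply: val_inj; exact: mul1mx. Qed.
Lemma GL_mulr1 : right_id GL_one GL_mul.
Proof. by move=> g; apply: val_inj; exact: mulmx1. Qed.
Lemma GL_mulV : left_inverse GL_one GL_inv GL_mul.
Proof. by move=> g; apply: val_inj; exact: (mulVmx (valP g)). Qed.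
Lemma GL_mulrV : right_inverse GL_one GL_inv GL_mul.
Proof. by move=> g; apply: val_inj; exact: (mulmxV (valP g)). Qed.

HB.instance Definition _ :=
  isGroup.Build (GL F n) GL_mulA GL_mul1 GL_mulr1 GL_mulV GL_mulrV.

End GLGroup.

(* The subspace topology from 'M[F]_n; inversion is continuous for it since F
   is a topological field. *)
HB.instance Definition _ (R : realType) (F : nonArchLocalFieldType R) n :=
  Topological.copy (GL F n) (initial_topology (val : GL F n -> 'M[F]_n)).

Section GLEmbedding.
Variables (F : fieldType) (n : nat).

Lemma GL_embed_subproof (g : GL F n) :
  block_mx (val g) 0 0 (1%:M : 'M[F]_1) \in unitmx.
Proof. by rewrite unitmxE det_ublock det1 mulr1 -unitmxE (valP g). Qed.

(* g |-> diag(g, 1) *)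
Definition GL_embed (g : GL F n) : GL F (n + 1) :=
  exist _ (block_mx (val g) 0 0 1%:M) (GL_embed_subproof g).

Lemma GL_embed_morph : monoid.monoid_morphism GL_embed.
Proof.
split=> [|g h]; apply: val_inj => /=; first by rewrite -scalar_mx_block.
by rewrite mulmx_block !(mulmx0, mul0mx, mulmx1, addr0, add0r).
Qed.

HB.instance Definition _ :=
  isUMagmaMorphism.Build (GL F n) (GL F (n + 1)) GL_embed GL_embed_morph.

End GLEmbedding.

Section Representations.
Variable K : fieldType.

(* Representations are on arbitrary, possibly infinite-dimensional spaces. *)
Record representation (G : groupType) (V : lmodType K) := Representation {
  repr_act :> G -> {linear V -> V};
  repr_act1 : forall v, repr_act 1%g v = v;
  repr_actM : forall g h v, repr_act (g * h)%g v = repr_act g (repr_act h v)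
}.

Section Restriction.
Variables (G H : groupType) (i : UMagmaMorphism.type H G).
Variables (V : lmodType K) (rho : representation G V).

Lemma res_repr1 v : rho (i 1%g) v = v.
Proof. by rewrite (gmulf1 (s := i)) repr_act1. Qed.
Lemma res_reprM g h v : rho (i (g * h)%g) v = rho (i g) (rho (i h) v).
Proof. by rewrite (gmulfM (s := i)) repr_actM. Qed.

Definition res_repr : representation H V :=
  Representation (repr_act := rho \o i) res_repr1 res_reprM.

End Restriction.

Definition smooth_repr (G : preTopologicalGroupType) (V : lmodType K)
    (rho : representation G V) :=
  forall v, open [set g | rho g v = v].

Definition irreducible_repr (G : groupType) (V : lmodType K)
    (rho : representation G V) :=
  (exists v : V, v != 0) /\
  forall W : set V, submod_closed (mem W) -> (forall g v, W v -> W (rho g v)) ->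
    W = [set 0] \/ W = [set: V].

Definition one_dimensional (V : lmodType K) :=
  exists2 v : V, v != 0 & forall w : V, exists a : K, w = a *: v.

Definition Hom_repr (G : groupType) (V W : lmodType K)
    (rho : representation G V) (sigma : representation G W) : set (V -> W) :=
  [set f | linear f /\ forall g v, f (rho g v) = sigma g (f v)].

Definition repr_iso (G : groupType) (V W : lmodType K)
    (rho : representation G V) (sigma : representation G W) :=
  exists2 f, Hom_repr rho sigma f & bijective f.

End Representations.

(* Main.v *)
(* A nonzero f : pi2 -> pi1 sends v to a vector w = f v which, by Schur's lemma
   for pi2, is an eigenvector of every diag(a, ..., a, 1).  Conjugation by these
   elements rescales the transvections along the last row and column, so w,
   being fixed by an open subgroup, is fixed by all of them (the Mautner
   phenomenon), hence, by commutators, by all transvections.  The vectors fixed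
   by all transvections form a subrepresentation, which must be all of pi1;
   since GL is generated by transvections and diagonal matrices, pi1 has abelian
   image, and Schur's lemma for pi1 makes it one-dimensional.  Schur's lemma
   holds because F is separable, so that representations generated by a smooth
   vector have countable dimension. *)

Require Import Defs.
From HB Require Import structures.
From mathcomp Require Import all_boot all_order all_algebra.
From mathcomp Require Import all_classical all_reals all_analysis.
From mathcomp Require Import complex.

Import Order.TTheory GRing.Theory Num.Theory.
Local Open Scope classical_set_scope.
Local Open Scope ring_scope.

(** * Ultrametric absolute values and separability *)

Section AbsoluteValue.
Context {R : realType} {F : nonArchLocalFieldType R}.
Implicit Types x y : F.

Lemma absv0 : absv (0 : F) = 0.
Proof. by apply/eqP; rewrite absv_eq0. Qed.

Lemma absv_gt0 x : x != 0 -> 0 < absv x.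
Proof. by move=> x0; rewrite lt_neqAle eq_sym absv_eq0 x0 absv_ge0. Qed.

Lemma absv1 : absv (1 : F) = 1.
Proof.
have h0 : absv (1 : F) != 0 by rewrite absv_eq0 oner_eq0.
by apply: (mulfI h0); rewrite -absvM !mulr1.
Qed.

Lemma absvX x k : absv (x ^+ k) = absv x ^+ k.
Proof. by elim: k => [|k IH]; rewrite ?expr0 ?absv1 // !exprS absvM IH. Qed.

Lemma absvN x : absv (- x) = absv x.
Proof.
suff h : absv (-1 : F) = 1 by rewrite -mulN1r absvM h mul1r.
by apply/eqP; rewrite -(eqrXn2 (n := 2)) ?absv_ge0 // -absvX sqrrN !expr1n absv1.
Qed.

Lemma absv_distC x y : absv (x - y) = absv (y - x).
Proof. by rewrite -absvN opprB. Qed.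

Lemma absvD_lt x y e : absv x < e -> absv y < e -> absv (x + y) < e.
Proof. by move=> xe ye; apply: le_lt_trans (absvD_max x y) _; rewrite gt_max xe. Qed.

Lemma absv_sum_lt n (f : 'I_n -> F) e :
  0 < e -> (forall i, absv (f i) < e) -> absv (\sum_i f i) < e.
Proof.
move=> e0 fe; elim/big_ind: _ => [|x y xe ye|i _]; first by rewrite absv0.
  exact: absvD_lt.
exact: fe.
Qed.

Lemma absv_gt1 : exists a : F, 1 < absv a.
Proof.
have [x [x0 x1]] := absv_nontrivial (s := F).
have := absv_gt0 _ x0; move: x1; rewrite neq_lt => /orP[x1 xp|]; last by exists x.
exists x^-1; rewrite -(ltr_pM2l xp) -absvM mulfV // absv1 mulr1 //.
Qed.

(** Bernoulli's inequality and the Archimedean property. *)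
Lemma exprn_gt_bound (c M : R) : 1 < c -> exists k, M < c ^+ k.
Proof.
move=> c1; have d0 : 0 < c - 1 by rewrite subr_gt0.
have bern k : (c - 1) *+ k <= c ^+ k.
  elim: k => [|k IH]; first by rewrite mulr0n expr0 ler01.
  rewrite mulrSr exprS -[X in X * _](subrK 1) mulrDl mul1r addrC lerD //.
  by rewrite ler_peMr ?(ltW d0) // exprn_ege1 // ltW.
exists (Num.bound (`|M| / (c - 1))); apply: lt_le_trans (bern _).
apply: le_lt_trans (ler_norm M) _; rewrite -mulr_natr mulrC -ltr_pdivrMr //.
by apply: archi_boundP; rewrite divr_ge0 // ltW.
Qed.

Lemma absv_lt_scale x e : 0 < e -> exists2 a : F, a != 0 & absv (a * x) < e.
Proof.
move=> e0; have [b b1] := absv_gt1.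
have b0 : b != 0 by apply: contraTneq b1 => ->; rewrite absv0 -leNgt ler01.
have [k Mk] := exprn_gt_bound _ (absv x / e) b1.
exists (b ^+ k)^-1; first by rewrite invr_eq0 expf_eq0 (negbTE b0) andbF.
have p : 0 < absv b ^+ k by rewrite exprn_gt0 // (lt_trans ltr01).
rewrite -(ltr_pM2l p) -absvX -absvM mulrA mulfV ?mul1r; last first.
  by rewrite expf_eq0 (negbTE b0) andbF.
by rewrite absvX -ltr_pdivrMr.
Qed.

(** A compact neighbourhood of [0] contains a ball and has finite nets. *)
Lemma ball_totally_bounded : exists2 r : R, 0 < r & forall e : R, 0 < e ->
  exists s : seq F, forall x, absv x < r -> exists2 y, y \in s & absv (x - y) < e.
Proof.
have := absv_locally_compact (s := F) 0 I; rewrite withinET.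
case=> C; rewrite nbhs_absvE => -[r /= r0 rC] [Ccpt _].
exists r => // e e0.
(* Near-covering compactness, taken along finite sequences ordered by inclusion, yields a single
   finite net. *)
pose G := filter_from [set: seq F] (fun s => [set t : seq F | {subset s <= t}]).
have FG : Filter G.
  apply: filter_from_filter; first by exists [::].
  by move=> s t _ _; exists (s ++ t) => // u su; split=> x xs; apply: su;
    rewrite mem_cat xs ?orbT.
have /compact_near_coveringP/(_ _ G
  (fun s x => exists2 y, y \in s & absv (x - y) < e) FG) := Ccpt.
case=> [x Cx|s _ sP]; last first.
  by exists s => x xr; apply: (sP s) => //; apply: rC => /=; rewrite subr0.
exists ([set y | absv (y - x) < e], [set t : seq F | {subset [:: x] <= t}]).
  split; last by exists [:: x].
  by rewrite nbhs_absvE; exists e.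
move=> [y t] [/= ye st]; exists x => //.
by apply: st; rewrite inE.
Qed.

(** Finite nets of a small ball, rescaled by all powers of some [b] with [1 < absv b], form a
    countable dense family. *)
Lemma local_field_separable :
  exists d : nat -> F, forall x e, 0 < e -> exists i, absv (x - d i) < e.
Proof.
have [r r0 tb] := ball_totally_bounded.
have [b b1] := absv_gt1.
have b0 : b != 0 by apply: contraTneq b1 => ->; rewrite absv0 -leNgt ler01.
have p k : 0 < absv b ^+ k by rewrite exprn_gt0 // (lt_trans ltr01).
have bk k : b ^+ k != 0 by rewrite expf_eq0 (negbTE b0) andbF.
have /choice [s sP] : forall m, exists s : seq F, forall x, absv x < r ->
    exists2 y, y \in s & absv (x - y) < (absv b ^+ m)^-1.
  by move=> m; apply: tb; rewrite invr_gt0.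
pose d i := if unpickle i is Some (k, m, j) then b ^+ k * nth 0 (s m) j else 0.
exists d => x e e0.
(* [k] shrinks [x] into the ball; [m] makes the net so fine that scaling back by [b ^+ k] leaves an
   error below [e]. *)
have [k kP] := exprn_gt_bound _ (absv x / r) b1.
have [m mP] := exprn_gt_bound _ (absv b ^+ k / e) b1.
have [|y ys xy] := sP m (x / b ^+ k).
  rewrite -(ltr_pM2l (p k)) -absvX -absvM mulrCA mulfV // mulr1 absvX.
  by rewrite -ltr_pdivrMr.
exists (pickle (k, m, index y (s m))); rewrite /d pickleK nth_index //.
have -> : x - b ^+ k * y = b ^+ k * (x / b ^+ k - y).
  by rewrite mulrBr mulrCA mulfV // mulr1.
rewrite absvM absvX; apply: lt_trans (_ : absv b ^+ k / absv b ^+ m < _).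
  by rewrite ltr_pM2l.
by rewrite ltr_pdivrMr // mulrC -ltr_pdivrMr.
Qed.

End AbsoluteValue.

(** * Smooth vectors have countable orbits *)

Section CountableOrbit.
Context {R : realType} {F : nonArchLocalFieldType R} {K : fieldType}.
Context {m : nat} {V : lmodType K} {rho : representation (GL F m) V}.
Hypothesis smooth : smooth_repr rho.

(** An open stabiliser contains an entrywise neighbourhood of [1]; the radius is the least of
    finitely many. *)
Lemma smooth_fixed_ball v : exists2 e : R, 0 < e & forall h : GL F m,
  (forall i j, absv ((val h - 1%:M) i j) < e) -> rho h v = v.
Proof.
have [U oU UE] := smooth v.
have : nbhs (val (GL_one F m)) U.
  apply: open_nbhs_nbhs; split => //.
  suff : (val @^-1` U) (1%g : GL F m) by [].
  by rewrite UE /= repr_act1.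
case=> P nP PU.
have /choice [e eP] : forall ij : 'I_m * 'I_m, exists e : R, 0 < e /\
    forall y, absv (y - (1%:M : 'M[F]_m) ij.1 ij.2) < e -> P ij.1 ij.2 y.
  move=> [i j]; have := nP i j; rewrite nbhs_absvE => -[e e0 eP].
  by exists e; split.
(* The initial value [1] keeps the radius positive even when [m = 0]. *)
exists (\big[Num.min/1]_ij e ij).
  by apply: lt_bigmin => // ij _; case: (eP ij).
move=> h hP; suff : (val @^-1` U) h by rewrite UE.
apply: PU => i j /=; apply: (eP (i, j)).2 => /=.
by have := hP i j; rewrite !mxE => /lt_le_trans; apply; apply: bigmin_le.
Qed.

(** If [h] is close enough to [g], then [g^-1 * h] fixes [v]; by separability countably many [h]
    suffice. *)
Lemma countable_orbit v :
  exists hs : nat -> GL F m, forall g, exists k, rho g v = rho (hs k) v.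
Proof.
have [d dP] := local_field_separable (F := F).
pose B (j : nat) (A : 'M[nat]_m) := [set h : GL F m |
  forall k l, absv (val h k l - d (A k l)) < j.+1%:R^-1].
(* The matrix of the [d (A k l)] may be singular, so an invertible one near it is chosen, by default
   [1]. *)
pose hs i : GL F m := if unpickle i is Some (j, A) then xget 1%g (B j A) else 1%g.
exists hs => g; have [e e0 eP] := smooth_fixed_ball v.
pose M0 : R := \big[Num.max/0]_(ij : 'I_m * 'I_m) absv (val (g^-1)%g ij.1 ij.2).
have gM i j : absv (val (g^-1)%g i j) < 1 + M0.
  apply: (@le_lt_trans _ _ M0); last by rewrite ltrDr ltr01.
  exact: (le_bigmax _ (fun ij => absv (val (g^-1)%g ij.1 ij.2)) (i, j)).
have M0p : 0 < 1 + M0 by rewrite ltr_wpDr ?bigmax_ge_id.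
(* If [h - g] is below [1 / (j + 1)] entrywise, then [g^-1 * (h - g)] is below [e]; ultrametric sums
   cost no factor. *)
pose j := Num.bound ((1 + M0) / e).
have jP : (1 + M0) * j.+1%:R^-1 < e.
  rewrite mulrC ltr_pdivrMl // -ltr_pdivrMr //; apply: (@lt_le_trans _ _ j%:R).
    by apply: archi_boundP; rewrite divr_ge0 // ltW.
  by rewrite ler_nat.
have /choice [A AP] : forall kl : 'I_m * 'I_m, exists i,
    absv (val g kl.1 kl.2 - d i) < j.+1%:R^-1.
  by move=> kl; apply: dP; rewrite invr_gt0 ltr0n.
pose A' : 'M[nat]_m := \matrix_(k, l) A (k, l).
have Bg : B j A' g by move=> k l; rewrite mxE; exact: (AP (k, l)).
have Bh : B j A' (xget 1%g (B j A')) by apply: xgetPex; exists g.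
exists (pickle (j, A')); rewrite /hs pickleK.
set h := xget _ _ in Bh *.
have -> : h = (g * (g^-1 * h))%g by rewrite mulgA mulgV mul1g.
rewrite repr_actM [in RHS]eP // => k l.
have -> : val (g^-1 * h)%g - 1%:M = val (g^-1)%g *m (val h - val g).
  by rewrite mulmxBr -[val (g^-1)%g *m val g]/(val (g^-1 * g)%g) mulVg.
rewrite mxE; apply: absv_sum_lt => // i; rewrite absvM; apply: lt_trans jP.
apply: ltr_pM; rewrite ?absv_ge0 // !mxE.
have -> : val h i l - val g i l =
    (val h i l - d (A' i l)) + (d (A' i l) - val g i l) by rewrite addrA subrK.
by apply: absvD_lt; [exact: Bh|rewrite absv_distC; exact: Bg].
Qed.

End CountableOrbit.

(** * Polynomials in an endomorphism *)

Section PolynomialAction.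
Context {K : fieldType} {V : lmodType K}.
Variable T : {linear V -> V}.
Implicit Types (p q : {poly K}) (u v : V).

Definition poly_act p v := \sum_(i < size p) p`_i *: iter i T v.

Lemma poly_actE n p v : (size p <= n)%N ->
  poly_act p v = \sum_(i < n) p`_i *: iter i T v.
Proof.
move=> sn; rewrite /poly_act (big_ord_widen n (fun i => p`_i *: iter i T v)) //.
rewrite big_mkcond; apply: eq_bigr => i _; case: ltnP => // ni.
by rewrite nth_default // scale0r.
Qed.

Lemma poly_act_scale_add a p q v :
  poly_act (a *: p + q) v = a *: poly_act p v + poly_act q v.
Proof.
pose n := maxn (size (a *: p + q)) (maxn (size p) (size q)).
rewrite !(@poly_actE n) /n ?leq_max ?leqnn ?orbT //.
rewrite scaler_sumr -big_split; apply: eq_bigr => i _ /=.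
by rewrite coefD coefZ scalerDl scalerA.
Qed.

Lemma poly_act0 v : poly_act 0 v = 0.
Proof. by rewrite /poly_act size_poly0 big_ord0. Qed.

Lemma iter_linear i a u v : iter i T (a *: u + v) = a *: iter i T u + iter i T v.
Proof. by elim: i => //= i ->; rewrite linearP. Qed.

Lemma poly_act_linear p : linear (poly_act p).
Proof.
move=> a u v; rewrite /poly_act scaler_sumr -big_split; apply: eq_bigr => i _ /=.
by rewrite iter_linear scalerDr !scalerA mulrC.
Qed.

HB.instance Definition _ p :=
  GRing.isLinear.Build K V V *:%R (poly_act p) (poly_act_linear p).

Lemma poly_actC c v : poly_act c%:P v = c *: v.
Proof. by rewrite (@poly_actE 1) ?size_polyC_leq1 // big_ord1 coefC. Qed.

Lemma poly_actMX p v : poly_act (p * 'X) v = poly_act p (T v).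
Proof.
rewrite (@poly_actE (size p).+1); last first.
  by rewrite (leq_trans (size_polyMleq _ _)) // size_polyX addn2.
rewrite big_ord_recl coefMX eqxx scale0r add0r /poly_act.
by apply: eq_bigr => i _; rewrite coefMX /= -iterSr iterS.
Qed.

Lemma poly_actMXsubC p a v :
  poly_act (p * ('X - a%:P)) v = poly_act p (T v - a *: v).
Proof.
have -> : p * ('X - a%:P) = (- a) *: p + p * 'X.
  by rewrite mulrBr [p * _%:P]mulrC mul_polyC scaleNr addrC.
rewrite poly_act_scale_add poly_actMX -poly_act_linear.
by rewrite scaleNr addrC.
Qed.

Hypothesis no_eigen : forall a v, T v = a *: v -> v = 0.

(** Each factor [T - a] is injective because [T] has no eigenvector. *)
Lemma poly_act_prod_XsubC_inj (s : seq K) v :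
  poly_act (\prod_(a <- s) ('X - a%:P)) v = 0 -> v = 0.
Proof.
elim: s v => [|a s IH] v; first by rewrite big_nil poly_actC scale1r.
rewrite big_cons mulrC poly_actMXsubC => /IH/eqP; rewrite subr_eq0 => /eqP.
exact: no_eigen.
Qed.

(* The vectors u_i = (T - a_i)^-1 v: clearing denominators turns a linear
   relation between them into a polynomial in T killing v. *)
Lemma resolvent_free (v : V) n (a : 'I_n -> K) (u : 'I_n -> V) (c : 'I_n -> K) :
  (forall p, p != 0 -> poly_act p v != 0) ->
  injective a -> (forall i, T (u i) - a i *: u i = v) ->
  \sum_i c i *: u i = 0 -> forall i, c i = 0.
Proof.
move=> vfree a_inj uP cu0.
(* The product of all [T - a j] maps [\sum_i c i *: u i] to P(T) v; at [a i] only the term of [c i]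
   in [P] survives. *)
pose Q i := \prod_(j | j != i) ('X - (a j)%:P).
pose P := \sum_i c i *: Q i.
have sumP (r : seq 'I_n) : poly_act (\sum_(i <- r) c i *: Q i) v =
    \sum_(i <- r) c i *: poly_act (Q i) v.
  elim: r => [|i r IH]; first by rewrite !big_nil poly_act0.
  by rewrite !big_cons poly_act_scale_add IH.
have P0 : P = 0.
  apply/eqP; apply: contraT => /vfree; rewrite /P sumP.
  have := linear0 (poly_act (\prod_j ('X - (a j)%:P))).
  rewrite -{1}cu0 linear_sum => {2}<- /eqP[]; apply: eq_bigr => i _.
  rewrite linearZ /=.
  by rewrite (bigD1 i) //= mulrC poly_actMXsubC uP.
move=> i; have /eqP : P.[a i] = 0 by rewrite P0 horner0.
rewrite /P horner_sum (bigD1 i) //= big1 ?addr0 => [|j ji]; last first.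
  by rewrite hornerZ horner_prod (bigD1 i) 1?eq_sym //= hornerXsubC subrr mul0r mulr0.
rewrite hornerZ horner_prod mulf_eq0 => /orP[/eqP//|].
rewrite prodf_seq_eq0 => /hasP[j _ /andP[ji]].
by rewrite hornerXsubC subr_eq0 => /eqP/a_inj ij; rewrite ij eqxx in ji.
Qed.

End PolynomialAction.

(** * Counting: uncountability of the reals and linear dependence *)

Lemma uncountable_real (R : realType) : ~ countable [set: R].
Proof.
move=> /(sub_countable (A := `[0, 1]%classic)) c.
have : lebesgue_measure (`[0, 1]%classic : set R) = 0%E.
  by apply: countable_lebesgue_measure0; apply: c; apply: subset_card_le.
by rewrite lebesgue_measure_itv /= lte_fin ltr01 sube0 => /eqP; rewrite eqe oner_eq0.
Qed.

Lemma real_cover_infinite (R : realType) (P : nat -> set R) :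
  (forall x, exists N, P N x) -> exists N, infinite_set (P N).
Proof.
move=> Pcover; apply: contrapT => /forallNP fin; apply: (@uncountable_real R).
have -> : [set: R] = \bigcup_N P N.
  by apply/seteqP; split=> // x _; have [N ?] := Pcover x; exists N.
apply: bigcup_countable => // N _; apply: finite_set_countable.
exact: contrapT (fin N).
Qed.

Lemma infinite_set_injection {T : choiceType} (A : set T) n :
  infinite_set A -> exists2 f : 'I_n -> T, injective f & forall i, A (f i).
Proof.
move=> /(infinite_set_fset n)[B BA nB].
exists (fun i => tnth (in_tuple (finmap.enum_fset B)) (widen_ord nB i)).
  move=> i j; have x0 := tnth (in_tuple (finmap.enum_fset B)) (widen_ord nB i).
  rewrite !(tnth_nth x0) /= => /eqP.
  rewrite nth_uniq ?finmap.fset_uniq ?(leq_trans (ltn_ord _) nB) //.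
  by move=> /eqP ij; apply: val_inj.
by move=> i; apply: BA; rewrite /=; exact: mem_tnth.
Qed.

(** More rows than columns force a nonzero vector in the left kernel of the coefficient matrix. *)
Lemma wide_system_relation {K : fieldType} {V : lmodType K} n
    (e : 'I_n -> V) (u : 'I_n.+1 -> V) (M : 'I_n.+1 -> 'I_n -> K) :
  (forall i, u i = \sum_k M i k *: e k) ->
  exists c : 'I_n.+1 -> K, \sum_i c i *: u i = 0 /\ exists i, c i != 0.
Proof.
move=> uE; pose A := \matrix_(i, k) M i k.
have : kermx A != 0.
  by rewrite kermx_eq0 /row_free neq_ltn ltnS rank_leq_col.
case/rowV0Pn => c /sub_kermxP cA /rV0Pn[i ci].
exists (c 0); split; last by exists i.
under eq_bigr do rewrite uE scaler_sumr.
rewrite exchange_big big1 // => k _.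
under eq_bigr do rewrite scalerA.
rewrite -scaler_suml.
have := congr1 (fun B : 'rV_n => B 0 k) cA; rewrite !mxE => cA0.
rewrite [X in X *: _](_ : _ = 0) ?scale0r // -[RHS]cA0.
by apply: eq_bigr => j _; rewrite mxE.
Qed.

(** * Irreducibility and Schur's lemma in countable dimension *)

Section Irreducible.
Context {K : fieldType} {G : groupType} {V : lmodType K}.
Context {rho : representation G V}.
Hypothesis irr : irreducible_repr rho.

(** Irreducibility as an induction principle: a linear, stable property with one nonzero instance
    holds everywhere. *)
Lemma irreducible_submodule (W : set V) (w : V) :
  W 0 -> (forall a u v, W u -> W v -> W (a *: u + v)) ->
  (forall g v, W v -> W (rho g v)) -> W w -> w != 0 -> forall v, W v.
Proof.
move=> W0 WL Wg Ww w0 v; have [||E|->//] := irr.2 W.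
- split; first exact: mem_set.
  by move=> a x y /set_mem xW /set_mem yW; apply: mem_set; exact: WL.
- exact: Wg.
by move: Ww; rewrite E => /= E0; rewrite E0 eqxx in w0.
Qed.

End Irreducible.

Section Schur.
Context {R : realType} {G : groupType} {V : lmodType R[i]}.
Context {rho : representation G V}.
Hypothesis irr : irreducible_repr rho.
Hypothesis orb : forall v, exists hs : nat -> G, forall g, exists k, rho g v = rho (hs k) v.

(** The orbit of a nonzero vector is countable and spans a nonzero subrepresentation, hence all of
    [V]. *)
Lemma countable_span : exists e : nat -> V, forall v, exists n (c : 'I_n -> R[i]),
  v = \sum_(i < n) c i *: e i.
Proof.
have [[v0 v00] _] := irr; have [hs hsP] := orb v0.
exists (fun k => rho (hs k) v0) => v.
(* Coefficients are indexed by [nat] and cut off at [n], with the sum taken up to any [m >= n], so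
   that two members share a common range. *)
pose W : set V := [set w | exists n (c : nat -> R[i]),
  forall m, (n <= m)%N -> w = \sum_(i < m | (i < n)%N) c i *: rho (hs i) v0].
have W0 : W 0 by exists 0%N, (fun=> 0) => m _; rewrite big1.
have WL a u w : W u -> W w -> W (a *: u + w).
  move=> [n [c cP]] [n' [c' cP']].
  exists (maxn n n'), (fun i => (if (i < n)%N then a * c i else 0) +
    if (i < n')%N then c' i else 0) => m nm.
  move: (nm); rewrite geq_max => /andP[nm1 nm2].
  rewrite (cP m nm1) (cP' m nm2) scaler_sumr big_mkcond [X in _ + X = _]big_mkcond.
  rewrite [RHS]big_mkcond -big_split; apply: eq_bigr => i _ /=.
  rewrite leq_max scalerDl.
  case: ltnP => _; case: ltnP => _; rewrite /= ?scalerA ?scale0r ?addr0 //.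
have We k : W (rho (hs k) v0).
  exists k.+1, (fun i => (i == k)%:R) => m km.
  rewrite (bigD1 (Ordinal km)) /= ?ltnS // eqxx scale1r big1 ?addr0 // => i.
  by rewrite -val_eqE /= => /andP[_ /negbTE->]; rewrite scale0r.
have Wsum n (c : nat -> R[i]) g (P : pred 'I_n) :
    W (rho g (\sum_(i < n | P i) c i *: rho (hs i) v0)).
  rewrite linear_sum; elim/big_ind: _ => // [x y|i _].
    by move=> xW yW; rewrite -[x]scale1r; exact: WL.
  rewrite linearZ /= -repr_actM -[X in W X]addr0; apply: WL => //.
  by have [k ->] := hsP (g * hs i)%g.
have [n [c cP]] : W v.
  apply: (irreducible_submodule irr W v0) => // [g w [n [c cP]]|].
    by rewrite (cP n (leqnn n)); exact: Wsum.
  by have [k] := hsP 1%g; rewrite repr_act1 => ->.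
by exists n, (fun i => c i); rewrite (cP n (leqnn n)); apply: eq_bigl => i; rewrite ltn_ord.
Qed.

(* Dixmier's argument: if T were not scalar, the vectors (T - x)^-1 v0, x real,
   would be an uncountable free family in a space of countable dimension. *)
Lemma schur (T : {linear V -> V}) : (forall g v, T (rho g v) = rho g (T v)) ->
  exists a, forall v, T v = a *: v.
Proof.
move=> Tg; apply: contrapT => nscal.
(* Eigenspaces of [T] are subrepresentations, so one eigenvector would make [T] scalar. *)
have no_eigen a v : T v = a *: v -> v = 0.
  move=> Tv; apply/eqP; apply: contraT => v0; exfalso; apply: nscal; exists a.
  apply: (irreducible_submodule irr [set u | T u = a *: u] v) => //=.
  - by rewrite linear0 scaler0.
  - by move=> b u w Tu Tw; rewrite linearP Tu Tw scalerDr !scalerA mulrC.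
  - by move=> g u Tu; rewrite Tg Tu linearZ.
have [[v0 v00] _] := irr.
(* The range of [T - x] is a nonzero subrepresentation, so it contains [v0]. *)
have resolvent (x : R) : exists u, T u - (x%:C)%C *: u = v0.
  set a := (x%:C)%C.
  apply: (irreducible_submodule irr [set v | exists u, T u - a *: u = v]
    (T v0 - a *: v0)) => /=.
  - by exists 0; rewrite linear0 scaler0 subrr.
  - move=> b _ _ [u <-] [w <-]; exists (b *: u + w).
    by rewrite linearP scalerBr scalerDr opprD !scalerA [a * b]mulrC addrACA.
  - by move=> g _ [u <-]; exists (rho g u); rewrite Tg linearB [X in _ = _ - X]linearZ.
  - by exists v0.
  - by apply: contra v00; rewrite subr_eq0 => /eqP/no_eigen/eqP.
have [U UP] := choice resolvent.
have [e eP] := countable_span.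
(* [P n] collects the [x] whose resolvent vector lies in the span of the first [n] generators; an
   infinite [P n] gives [n + 1] dependent vectors there. *)
pose P n := [set x : R | exists c : 'I_n -> R[i], U x = \sum_(i < n) c i *: e i].
have [n Pinf] : exists n, infinite_set (P n).
  by apply: real_cover_infinite => x; have [n [c cP]] := eP (U x); exists n, c.
have [x x_inj xP] := infinite_set_injection _ n.+1 Pinf.
have [M MP] := choice xP.
have [c [cu0 [i ci]]] := wide_system_relation _ (fun k => e k) (fun i => U (x i)) M MP.
suff ci0 : c i = 0 by rewrite ci0 eqxx in ci.
apply: (resolvent_free T v0 n.+1 (fun i => (x i)%:C)%C (fun i => U (x i))) => //.
(* Over the complex numbers [p] splits, and its linear factors are injective at [T]. *)
- move=> p p0; apply: contra v00 => /eqP pv.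
  have [s sP] := closed_field_poly_normal p.
  move: pv; rewrite sP -[_ *: \prod_(z <- s) _]addr0 poly_act_scale_add poly_act0 addr0 => /eqP.
  rewrite scaler_eq0 lead_coef_eq0 (negbTE p0) /= => /eqP.
  by move=> /(poly_act_prod_XsubC_inj _ no_eigen)/eqP.
- by move=> j k /(fmorph_inj (@real_complex R)) /x_inj.
Qed.

End Schur.

(** * Generation of the general linear group by transvections and diagonal matrices *)

Section Transvections.
Context {F : fieldType}.

Definition transvection {n} (i j : 'I_n) (x : F) : 'M[F]_n :=
  1%:M + x *: delta_mx i j.

Lemma transvectionD n (i j : 'I_n) x y : i != j ->
  transvection i j x *m transvection i j y = transvection i j (x + y).
Proof.
move=> ij; rewrite /transvection mulmxDl mul1mx mulmxDr mulmx1.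
rewrite -scalemxAl -scalemxAr mul_delta_mx_0 1?eq_sym // !scaler0 addr0.
by rewrite -addrA -scalerDl addrC [y + x]addrC addrC.
Qed.

Lemma transvection0 n (i j : 'I_n) : transvection i j 0 = 1%:M.
Proof. by rewrite /transvection scale0r addr0. Qed.

Lemma transvectionN n (i j : 'I_n) x : i != j ->
  transvection i j x *m transvection i j (- x) = 1%:M.
Proof. by move=> ij; rewrite transvectionD // subrr transvection0. Qed.

Lemma unitmx_transvection n (i j : 'I_n) x : i != j ->
  transvection i j x \in unitmx.
Proof. by move=> ij; have [] := mulmx1_unit (transvectionN _ _ _ x ij). Qed.

(** The commutator relation [[e_ik(x), e_kj(1)] = e_ij(x)], cleared of inverses. *)
Lemma transvection_commutator n (i k j : 'I_n) x :
  i != k -> k != j -> i != j ->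
  transvection i j x *m (transvection k j 1 *m transvection i k x) =
  transvection i k x *m transvection k j 1.
Proof.
move=> ik kj ij; rewrite /transvection scale1r.
rewrite !(mulmxDl, mulmxDr, mul1mx, mulmx1) -!(scalemxAl, scalemxAr).
rewrite mul_delta_mx !mul_delta_mx_0 1?eq_sym // !scaler0 !addr0 -!addrA.
by rewrite mulmx0 !scaler0 !addr0; congr (_ + _); rewrite addrCA.
Qed.

Lemma diag_mx_transvection n (d : 'rV[F]_n) (i j : 'I_n) x : d 0 j != 0 ->
  diag_mx d *m transvection i j x =
  transvection i j (d 0 i * x / d 0 j) *m diag_mx d.
Proof.
move=> dj; rewrite /transvection mulmxDr mulmx1 mulmxDl mul1mx; congr (_ + _).
rewrite -scalemxAr -scalemxAl; apply/matrixP=> k l.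
rewrite mul_diag_mx mul_mx_diag !mxE.
case: eqP => [->|_]; case: eqP => [->|_]; rewrite /= ?(mulr0, mul0r) //.
by rewrite mulr1 mul1r divfK // mulrC.
Qed.

(** Gaussian elimination: around a nonzero pivot the first row and column are cleared, and induction
    treats the remaining block. *)
Lemma unitmx_gen n (P : 'M[F]_n -> Prop) :
  (forall A B, P A -> P B -> P (A *m B)) ->
  (forall i j x, i != j -> P (transvection i j x)) ->
  (forall d, P (diag_mx d)) ->
  forall A, A \in unitmx -> P A.
Proof.
elim: n P => [|n IH] P PM PT PD A.
  by have := PD 0; rewrite (_ : diag_mx 0 = A) // [RHS]flatmx0 [LHS]flatmx0.
move: P PM PT PD A; rewrite -add1n => P PM PT PD.
have P1 : P 1%:M by have := PD (const_mx 1); rewrite diag_const_mx.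
have PL (c : 'cV_n) : P (block_mx 1%:M 0 c 1%:M).
  rewrite [c]matrix_sum_delta; elim/big_ind: _ => [|c1 c2 h1 h2|i _].
  - by rewrite -scalar_mx_block.
  - have := PM _ _ h1 h2.
    by rewrite mulmx_block !(mulmx0, mul0mx, mulmx1, mul1mx, addr0, add0r).
  rewrite big_ord1; have := PT (rshift 1 i) (lshift n ord0) (c i 0) isT.
  rewrite /transvection delta_mx_dshift delta_mx_lshift scalar_mx_block.
  have -> : c i 0 *: col_mx 0 (row_mx (delta_mx i ord0) 0) =
      block_mx (0 : 'M[F]_1) 0 (c i 0 *: delta_mx i ord0) (0 : 'M[F]_n).
    by rewrite /block_mx row_mx0 scale_col_mx scale_row_mx !scaler0.
  by rewrite add_block_mx !addr0 add0r.
have PU (b : 'rV_n) : P (block_mx 1%:M b 0 1%:M).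
  rewrite [b]matrix_sum_delta big_ord1; elim/big_ind: _ => [|c1 c2 h1 h2|i _].
  - by rewrite -scalar_mx_block.
  - have := PM _ _ h1 h2.
    rewrite mulmx_block !(mulmx0, mul0mx, mulmx1, mul1mx, addr0, add0r).
    by rewrite addrC.
  have := PT (lshift n ord0) (rshift 1 i) (b 0 i) isT.
  rewrite /transvection delta_mx_ushift delta_mx_rshift scalar_mx_block.
  have -> : b 0 i *: col_mx (row_mx 0 (delta_mx ord0 i)) 0 =
      block_mx (0 : 'M[F]_1) (b 0 i *: delta_mx ord0 i) 0 (0 : 'M[F]_n).
    by rewrite /block_mx row_mx0 scale_col_mx scale_row_mx !scaler0.
  by rewrite add_block_mx !addr0 add0r.
have PB (B : 'M[F]_n) : B \in unitmx -> P (block_mx 1%:M 0 0 B).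
  apply: (IH (fun B => P (block_mx 1%:M 0 0 B))) => [B1 B2 h1 h2|i j x ij|d].
  - have := PM _ _ h1 h2.
    by rewrite mulmx_block !(mulmx0, mul0mx, mulmx1, mul1mx, addr0, add0r).
  - have := PT (rshift 1 i) (rshift 1 j) x; rewrite (inj_eq (@rshift_inj _ _)).
    move=> /(_ ij); rewrite /transvection delta_mx_dshift delta_mx_rshift.
    rewrite scalar_mx_block.
    have -> : x *: col_mx 0 (row_mx 0 (delta_mx i j)) =
        block_mx (0 : 'M[F]_1) 0 0 (x *: delta_mx i j).
      by rewrite /block_mx row_mx0 scale_col_mx scale_row_mx !scaler0.
    by rewrite add_block_mx !addr0.
  have := PD (row_mx (const_mx 1) d); rewrite diag_mx_row diag_const_mx //.
have Ppivot (A : 'M[F]_(1 + n)) : A \in unitmx -> A 0 0 != 0 -> P A.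
  move=> Au a0; pose a := A 0 0.
  have aE : ulsubmx A = a%:M.
    apply/matrixP=> i j; rewrite !ord1 !mxE eqxx /a; congr (A _ _); exact: val_inj.
  pose c := a^-1 *: dlsubmx A; pose b := a^-1 *: ursubmx A.
  (* [D] is the Schur complement of the pivot, and [AE] the resulting block LDU factorisation. *)
  pose D := drsubmx A - a^-1 *: (dlsubmx A *m ursubmx A).
  have AE : A = block_mx 1%:M 0 c 1%:M *m
      (block_mx a%:M 0 0 1%:M *m block_mx 1%:M 0 0 D) *m block_mx 1%:M b 0 1%:M.
    rewrite !mulmx_block !(mulmx0, mul0mx, mulmx1, mul1mx, addr0, add0r).
    rewrite !(mul_scalar_mx, mul_mx_scalar) /c /b !scalerA mulfV // !scale1r.
    by rewrite -scalemxAr /D addrC subrK -aE submxK.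
  rewrite AE; apply: (PM); last exact: PU.
  apply: (PM); first exact: PL.
  apply: PM; last first.
    apply: PB; move: Au; rewrite AE !unitmx_mul => /andP[/andP[_ /andP[_ Du]] _]; move: Du.
    by rewrite unitmxE det_ublock det1 mul1r -unitmxE.
  have := PD (row_mx (const_mx a) (const_mx 1)).
  by rewrite diag_mx_row !diag_const_mx.
move=> A Au; have [a0|] := eqVneq (A 0 0) 0; last exact: Ppivot.
have [i Ai] : exists i, A i 0 != 0.
  apply: contrapT => /forallNP A0.
  have : A *m delta_mx 0 (0 : 'I_1) = 0.
    apply/matrixP=> i j; rewrite -colE !mxE; apply/eqP.
    by apply: contraT => /A0.
  move=> /(congr1 (mulmx (invmx A))); rewrite mulmxA mulVmx // mul1mx mulmx0.
  by move=> /matrixP/(_ 0 0); rewrite !mxE !eqxx => /eqP; rewrite oner_eq0.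
have i0 : 0 != i by apply: contraNneq Ai => <-; rewrite a0.
(* Adding row [i] to row [0] creates the nonzero pivot [A i 0]. *)
have -> : A = transvection 0 i (- 1) *m (transvection 0 i 1 *m A).
  by rewrite mulmxA transvectionD // addNr transvection0 mul1mx.
apply: PM; first exact: PT.
apply: Ppivot; first by rewrite unitmx_mul unitmx_transvection.
rewrite /transvection mulmxDl mul1mx scale1r !mxE a0 add0r.
rewrite (bigD1 i) //= big1 ?addr0 => [|k ki]; rewrite !mxE !eqxx ?mul1r //.
by rewrite (negbTE ki) andbF mul0r.
Qed.

End Transvections.

Section GLGeneration.
Context {F : fieldType} {m : nat}.

Definition GL_transvection (i j : 'I_m) (x : F) (ij : i != j) : GL F m :=
  exist _ (transvection i j x) (unitmx_transvection _ i j x ij).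

(** The predicate passed to [unitmx_gen] holds vacuously on singular matrices, including singular
    diagonal ones. *)
Lemma GL_gen (P : GL F m -> Prop) :
  (forall g h, P g -> P h -> P (g * h)%g) ->
  (forall i j x (ij : i != j), P (GL_transvection i j x ij)) ->
  (forall g d, val g = diag_mx d -> P g) ->
  forall g, P g.
Proof.
move=> PM PT PD g.
apply: (unitmx_gen _ (fun A => forall g, val g = A -> P g) _ _ _ (val g) (valP g)) => //.
- move=> A B PA PB h hE; have := valP h; rewrite hE unitmx_mul => /andP[uA uB].
  have -> : h = ((exist _ A uA : GL F m) * (exist _ B uB : GL F m))%g by apply: val_inj.
  by apply: PM; [exact: PA|exact: PB].
- by move=> i j x ij h hE; rewrite (_ : h = GL_transvection i j x ij) //; apply: val_inj.
- by move=> d h; exact: PD.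
Qed.

Lemma GL_diag_neq0 (g : GL F m) d i : val g = diag_mx d -> d 0 i != 0.
Proof.
move=> gE; have := valP g; rewrite gE unitmxE det_diag unitfE => /prodf_neq0; exact.
Qed.

Lemma GL_diag_transvection (g : GL F m) d i j x (ij : i != j) :
  val g = diag_mx d ->
  (g * GL_transvection i j x ij =
   GL_transvection i j (d 0 i * x / d 0 j) ij * g)%g.
Proof.
move=> gE; apply: val_inj => /=; rewrite gE; apply: diag_mx_transvection.
exact: GL_diag_neq0 gE.
Qed.

End GLGeneration.

(** * Vectors fixed by all transvections *)

Section TransvectionFixed.
Context {F K : fieldType} {m : nat} {V : lmodType K}.
Variable rho : representation (GL F m) V.

Lemma repr_inj g : injective (rho g).
Proof.
by move=> u v /(congr1 (rho g^-1)%g); rewrite -!repr_actM mulVg !repr_act1.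
Qed.

Definition transvection_fixed : set V :=
  [set v | forall i j x (ij : i != j), rho (GL_transvection i j x ij) v = v].

(** Conjugation by a diagonal matrix only rescales the parameter of a transvection. *)
Lemma transvection_fixed_stable g v :
  transvection_fixed v -> transvection_fixed (rho g v).
Proof.
move: g v; apply: GL_gen => [g h gP hP v vW|i j x ij v vW|g d gE v vW i j x ij].
- by rewrite repr_actM; apply: gP; exact: hP.
- by rewrite vW.
have di := GL_diag_neq0 _ _ i gE; have dj := GL_diag_neq0 _ _ j gE.
(* The parameter is chosen so that it becomes [x] once the transvection has crossed [g]. *)
have := GL_diag_transvection g d i j (x * d 0 j / d 0 i) ij gE.
rewrite [d 0 i * _]mulrC divfK // mulfK // => E.
by rewrite -repr_actM -E repr_actM vW.
Qed.

Hypothesis irr : irreducible_repr rho.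
Hypothesis scal : forall T : {linear V -> V},
  (forall g v, T (rho g v) = rho g (T v)) -> exists a, forall v, T v = a *: v.

(** Transvections act trivially, so the image of [rho] comes from diagonal matrices and is abelian;
    by [scal] it acts by scalars, and the line of [w] is stable. *)
Lemma transvection_fixed_one_dimensional w :
  transvection_fixed w -> w != 0 -> one_dimensional V.
Proof.
move=> wW w0.
have W v : transvection_fixed v.
  apply: (irreducible_submodule irr _ w) v => //.
  - by move=> i j x ij; rewrite linear0.
  - by move=> a u v uW vW i j x ij; rewrite linearP uW vW.
  - exact: transvection_fixed_stable.
have diagC g d : val g = diag_mx d -> forall h v, rho g (rho h v) = rho h (rho g v).
  move=> gE; apply: GL_gen => [h1 h2 c1 c2 v|i j x ij v|h e hE v].
  - by rewrite !repr_actM c1 c2.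
  - by rewrite !W.
  by rewrite -!repr_actM; congr (rho _ _); apply: val_inj; rewrite /= gE hE diag_mxC.
have reprC g : forall h v, rho g (rho h v) = rho h (rho g v).
  move: g; apply: GL_gen => [g1 g2 c1 c2 h v|i j x ij h v|g d gE].
  - by rewrite !repr_actM c2 c1.
  - by rewrite !W.
  exact: diagC gE.
exists w => // v.
apply: (irreducible_submodule irr [set v | exists a, v = a *: w] w) v => //.
- by exists 0; rewrite scale0r.
- by move=> a _ _ [b ->] [c ->]; exists (a * b + c); rewrite scalerDl scalerA.
- move=> g _ [a ->]; have [b bP] := scal (rho g) (reprC g).
  by exists (b * a); rewrite bP scalerA.
by exists 1; rewrite scale1r.
Qed.

End TransvectionFixed.

(** * Contraction by scalar matrices of the smaller group *)

Section Contraction.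
Context {R : realType} {F : nonArchLocalFieldType R} {K : fieldType}.
Context {n : nat} {V : lmodType K} {rho : representation (GL F (n + 1)) V}.
Hypothesis smooth : smooth_repr rho.

(* Conjugation by diag(a, ..., a, 1) rescales the entries of the last row and
   the last column, hence moves them into the open stabiliser of w. *)
Lemma eigenvector_transvection_fixed w :
  (forall a (z : GL F n), a != 0 -> val z = a%:M ->
     exists mu, rho (GL_embed z) w = mu *: w) ->
  transvection_fixed rho w.
Proof.
move=> eig; have [e e0 eP] := smooth_fixed_ball smooth w.
have small i j x (ij : i != j) : absv x < e -> rho (GL_transvection i j x ij) w = w.
  move=> xe; apply: eP => k l; rewrite /= /transvection addrAC subrr add0r !mxE.
  by case: (_ && _); rewrite ?mulr1 // mulr0 absv0.
have contract (i j : 'I_(n + 1)) x (ij : i != j) a : a != 0 ->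
    absv (row_mx (const_mx a) (const_mx 1 : 'rV_1) 0 i * x /
          row_mx (const_mx a) (const_mx 1 : 'rV_1) 0 j) < e ->
    rho (GL_transvection i j x ij) w = w.
  move=> a0 /(small i j _ ij) fixed.
  have au : (a%:M : 'M[F]_n) \in unitmx.
    by rewrite unitmxE det_scalar unitfE expf_neq0.
  have [mu zw] := eig a (exist _ a%:M au) a0 erefl.
  set z := GL_embed _ in zw.
  have zE : val z = diag_mx (row_mx (const_mx a) (const_mx 1)).
    by rewrite diag_mx_row !diag_const_mx.
  (* Once moved across [z] the transvection is small; both sides are then [mu *: w]. *)
  apply: (repr_inj rho z); rewrite -repr_actM (GL_diag_transvection z _ i j x ij zE).
  by rewrite repr_actM zw linearZ /= fixed.
have col i x (ij : lshift 1 i != rshift n 0) :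
    rho (GL_transvection (lshift 1 i) (rshift n 0) x ij) w = w.
  have [a a0 ax] := absv_lt_scale x e e0.
  by apply: (contract _ _ x ij a a0); rewrite row_mxEl row_mxEr !mxE divr1.
have row i x (ij : rshift n 0 != lshift 1 i) :
    rho (GL_transvection (rshift n 0) (lshift 1 i) x ij) w = w.
  have [a a0 ax] := absv_lt_scale x e e0.
  (* On the last row the conjugation divides by the scalar, so [a^-1] replaces [a]. *)
  apply: (contract _ _ x ij a^-1); rewrite ?invr_eq0 //.
  by rewrite row_mxEl row_mxEr !mxE mul1r invrK mulrC.
move=> i j x; case: (splitP i) (splitP j) => [i' /= iE|i' /= iE] [j' /= jE|j' /= jE].
- have -> : i = lshift 1 i' by apply: val_inj.
  have -> : j = lshift 1 j' by apply: val_inj.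
  (* With both indices in the smaller block, the transvection is a commutator through the last
     index. *)
  move=> ij; have ik : lshift 1 i' != rshift n 0 by rewrite eq_lrshift.
  have kj : rshift n 0 != lshift 1 j' by rewrite eq_rlshift.
  have E : (GL_transvection _ _ x ij * (GL_transvection _ _ 1 kj * GL_transvection _ _ x ik)
    = GL_transvection _ _ x ik * GL_transvection _ _ 1 kj)%g.
    by apply: val_inj; exact: transvection_commutator.
  have := congr1 (fun g => rho g w) E.
  by rewrite !repr_actM col row col.
- have -> : i = lshift 1 i' by apply: val_inj.
  have -> : j = rshift n 0 by apply: val_inj; rewrite /= jE ord1.
  exact: col.
- have -> : i = rshift n 0 by apply: val_inj; rewrite /= iE ord1.
  have -> : j = lshift 1 j' by apply: val_inj.
  exact: row.
by move=> /negP[]; apply/eqP/val_inj; rewrite /= iE jE !ord1.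
Qed.

End Contraction.

Theorem theorem1p6 (R : realType) (F : nonArchLocalFieldType R) (n : nat)
    (V1 V2 : lmodType R[i])
    (pi1 : representation (GL F (n + 1)) V1) (pi2 : representation (GL F n) V2)
    (smooth1 : smooth_repr pi1) (irr1 : irreducible_repr pi1)
    (smooth2 : smooth_repr pi2) (irr2 : irreducible_repr pi2) :
  Hom_repr pi2 (res_repr (@GL_embed F n) pi1) <> [set 0] <->
  [/\ one_dimensional V1, one_dimensional V2 &
      repr_iso pi2 (res_repr (@GL_embed F n) pi1)].
Proof.
split=> [Hneq0|[_ [v v0 _] [f [fL fG] fbij]] H0]; last first.
  have f0 : f = 0 by have : [set 0] f by rewrite -H0.
  by case/eqP: v0; apply: (bij_inj fbij); rewrite f0.
have [f [[fL fG] [v fv0]]] : exists f,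
    Hom_repr pi2 (res_repr (@GL_embed F n) pi1) f /\ exists v, f v != 0.
  (* The zero map is always a homomorphism, so a Hom set other than [[set 0]] has a nonzero
     member. *)
  apply: contrapT => nex; apply: Hneq0; apply/seteqP; split=> [f fH /=|_ ->].
    apply/funext => v; apply/eqP; apply: contraT => fv0.
    by exfalso; apply: nex; exists f; split => //; exists v.
  split=> [a u w|g w].
    by rewrite -[RHS]/(a *: (0 : V1) + 0) scaler0 addr0.
  by rewrite -[RHS]/(pi1 (GL_embed g) 0) linear0.
have f0 : f 0 = 0 by have := fL (-1) 0 0; rewrite !scaleN1r !addNr.
(* Scalar matrices are central, so Schur's lemma for [pi2] applies to their action. *)
have central a (z : GL F n) : a != 0 -> val z = a%:M ->
    exists mu, pi1 (GL_embed z) (f v) = mu *: f v.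
  move=> a0 zE.
  have [g u|mu muP] := schur irr2 (countable_orbit smooth2) (pi2 z).
    rewrite -!repr_actM; congr (pi2 _ _); apply: val_inj => /=.
    by rewrite zE scalar_mxC.
  by exists mu; rewrite -[LHS]fG muP -[mu *: v]addr0 fL f0 addr0.
have dim1 : one_dimensional V1.
  apply: (transvection_fixed_one_dimensional pi1 irr1 _ (f v)) => //.
    exact: schur irr1 (countable_orbit smooth1).
  exact: eigenvector_transvection_fixed smooth1 _ central.
(* The kernel of [f] is a subrepresentation missing [v]. *)
have ker u : f u = 0 -> u = 0.
  move=> fu; apply/eqP; apply: contraT => u0.
  have : f v = 0; last by move=> E; rewrite E eqxx in fv0.
  apply: (irreducible_submodule irr2 [set u | f u = 0] u _ _ _ _ _ v) => //=.
  - by move=> a x y fx fy; rewrite fL fx fy scaler0 addr0.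
  - by move=> g x fx; rewrite fG fx linear0.
have [w w0 wP] := dim1.
have [b fvE] := wP (f v).
have b0 : b != 0 by apply: contraNneq fv0 => b0; rewrite fvE b0 scale0r.
(* Every vector of [V1] is a multiple of [f v]; this gives surjectivity and, with injectivity, [V2]
   as the line of [v]. *)
have lift x : exists a, x = f (a *: v).
  have [a ->] := wP x; exists (a / b).
  by rewrite -[_ *: v]addr0 fL f0 addr0 fvE scalerA divfK.
have f_inj x y : f x = f y -> x = y.
  move=> fxy; apply/eqP; rewrite -subr_eq0 -scaleN1r addrC; apply/eqP/ker.
  by rewrite fL fxy scaleN1r addNr.
split=> //; first (exists v; [|move=> u]).
- by apply: contraNneq fv0 => ->; rewrite f0.
- by have [a /f_inj ua] := lift (f u); exists a.
have [g gP] := choice lift.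
exists f; first by split.
exists (fun x => g x *: v) => x; last by rewrite -gP.
by apply: f_inj; rewrite -gP.
Qed.
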